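(* Let $\mathfrak n$ be an 8-dimensional 2-step nilpotent Lie algebra with an HKT structure $(\{J_i\}_{i=1,2,3},g)$, let $\nabla$ be the Bismut connection of the induced invariant HKT structure on a Lie group with Lie algebra $\mathfrak n$, and let $\rho$ be its Ricci tensor. Let $\mathfrak z$ be the center of $\mathfrak n$ and $\mathfrak v=\mathfrak z^\perp$. Then $\rho(Z,X)=0$ for all $Z\in\mathfrak z$, $X\in\mathfrak n$, and there is a constant $\lambda>0$ such that $\rho(V,V)=-\lambda$ for all $V\in\mathfrak v$ with $\|V\|=1$. In particular $\rho$ has exactly two distinct eigenvalues, $0$ and $-\lambda$.
   Context: A hypercomplex structure on a (finite-dimensional real) Lie algebra $\mathfrak g$ is a triple of endomorphisms $\{J_i\}_{i=1,2,3}$ with $J_i^2=-I$, $J_1J_2=-J_2J_1=J_3$ and vanishing Nijenhuis tensors $N_i(X,Y)=J_i([X,Y]-[J_iX,J_iY])-([J_iX,Y]+[X,J_iY])$. An HKT structure on $\mathfrak g$ is a hypercomplex structure with an inner product $g$ such that $g(J_iX,J_iY)=g(X,Y)$ for $i=1,2,3$, and such that $g([J_iX,J_iY],Z)+g([J_iY,J_iZ],X)+g([J_iZ,J_iX],Y)$ is independent of $i\in\{1,2,3\}$ for all $X,Y,Z\in\mathfrak g$. Left translating $J_i$ and $g$ gives an invariant HKT structure on any Lie group with Lie algebra $\mathfrak g$; its Bismut connection is the unique connection $\nabla$ with $\nabla g=0$, $\nabla J_i=0$ ($i=1,2,3$) and with $c(X,Y,Z)=g(X,T(Y,Z))$ a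 3-form ($T$ the torsion of $\nabla$). The curvature is $R(X,Y)=[\nabla_X,\nabla_Y]-\nabla_{[X,Y]}$ and the Ricci tensor is $\rho(X,Y)=\sum_j g(R(e_j,X)Y,e_j)$ for an orthonormal basis $\{e_j\}$. A Lie algebra $\mathfrak n$ is 2-step nilpotent if $[\mathfrak n,\mathfrak n]\neq0$ and $[[\mathfrak n,\mathfrak n],\mathfrak n]=0$. *)

(* Defs.v *)
From HB Require Import structures.
From mathcomp Require Import all_boot all_order all_algebra.
From mathcomp Require Import reals.
Set Implicit Arguments.
Unset Strict Implicit.
Unset Printing Implicit Defensive.
Import Order.TTheory GRing.Theory Num.Theory.
Local Open Scope ring_scope.

Section LieAlgebra.
Variables (R : realType) (V : vectType R).
Implicit Types (br : {bilinear V -> V -> V}).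

Definition lie_bracket br : Prop :=
  (forall X, br X X = 0) /\
  (forall X Y Z, br X (br Y Z) + br Y (br Z X) + br Z (br X Y) = 0).

Definition lie_center br : {vspace V} :=
  (\bigcap_(i < \dim {:V}) lker (linfun (applyr br (vbasis {:V})`_i)))%VS.

Lemma mem_lie_centerP br Z : reflect (forall X, br Z X = 0) (Z \in lie_center br).
Proof.
apply: (iffP idP) => [Zc X|Zc]; last first.
  by apply/subv_bigcapP => i _; rewrite -memvE memv_ker lfunE /= Zc.
rewrite (coord_vbasis (memvf X)) linear_sumr big1 // => i _.
move/subv_bigcapP: Zc => /(_ i isT).
by rewrite -memvE memv_ker lfunE /= linearZr_LR /= => /eqP ->; rewrite scaler0.
Qed.

Definition two_step_nilpotent br : Prop :=
  (exists X Y, br X Y <> 0) /\ (forall X Y Z, br (br X Y) Z = 0).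

Definition nijenhuis br (J : 'End(V)) (X Y : V) : V :=
  J (br X Y - br (J X) (J Y)) - (br (J X) Y + br X (J Y)).

(* J 0, J 1, J 2 stand for J_1, J_2, J_3. *)
Definition hypercomplex br (J : 'I_3 -> 'End(V)) : Prop :=
  [/\ forall i X, J i (J i X) = - X,
      forall X, J 0 (J 1 X) = - J 1 (J 0 X),
      forall X, J 0 (J 1 X) = J 2 X &
      forall i X Y, nijenhuis br (J i) X Y = 0].

Variable g : {dot V for idfun}.

Definition hkt_form br (J : 'End(V)) (X Y Z : V) : R :=
  g (br (J X) (J Y)) Z + g (br (J Y) (J Z)) X + g (br (J Z) (J X)) Y.

Definition hkt br (J : 'I_3 -> 'End(V)) : Prop :=
  [/\ hypercomplex br J,
      forall i X Y, g (J i X) (J i Y) = g X Y &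
      forall i j X Y Z, hkt_form br (J i) X Y Z = hkt_form br (J j) X Y Z].

(* A left-invariant linear connection on a Lie group is encoded by its values
   on left-invariant vector fields, that is, by a bilinear map
   nabla : (X, Y) |-> nabla_X Y on the Lie algebra. *)
Definition torsion br (nabla : {bilinear V -> V -> V}) (X Y : V) : V :=
  nabla X Y - nabla Y X - br X Y.

(* For left-invariant X, Y, Z the function g(Y, Z) is constant, so that
   (nabla_X g)(Y, Z) = - g(nabla_X Y, Z) - g(Y, nabla_X Z). *)
Definition bismut br (J : 'I_3 -> 'End(V)) (nabla : {bilinear V -> V -> V}) :
    Prop :=
  let c X Y Z := g X (torsion br nabla Y Z) in
  [/\ forall X Y Z, g (nabla X Y) Z + g Y (nabla X Z) = 0,
      forall i X Y, nabla X (J i Y) = J i (nabla X Y),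
      forall X Z, c X X Z = 0 &
      forall X Z, c X Z Z = 0].

Definition curvature br (nabla : {bilinear V -> V -> V}) (X Y W : V) : V :=
  nabla X (nabla Y W) - nabla Y (nabla X W) - nabla (br X Y) W.

Definition orthonormal_basis (e : seq V) : Prop :=
  basis_of {:V} e /\ orthonormal g e.

Definition ricci br (nabla : {bilinear V -> V -> V}) (e : seq V) (X Y : V) : R :=
  \sum_(v <- e) g (curvature br nabla v X Y) v.

Definition metric_norm (X : V) : R := Num.sqrt (g X X).

End LieAlgebra.

(* Main.v *)
Require Import Defs.
From HB Require Import structures.
From mathcomp Require Import all_boot all_order all_algebra.
From mathcomp Require Import reals.
From mathcomp Require Import ring lra.
Set Implicit Arguments.
Unset Strict Implicit.
Unset Printing Implicit Defensive.
Import Order.TTheory GRing.Theory Num.Theory.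
Local Open Scope ring_scope.

(** Why the theorem is true. On a 2-step nilpotent Lie algebra an HKT structure
is necessarily abelian: [[J_i X, J_i Y] = [X, Y]] for every [i]
([hkt_abelian]). Indeed the defect [D = [X, Y] - [J_i X, J_i Y]] lies in the
largest [J]-invariant subspace of the center, because integrability puts both
[D] and [J_i D] in the center, and [central_core] upgrades this to the whole
quaternionic orbit of [D]. On the other hand the HKT condition, evaluated
against such a vector, says that [D] is orthogonal to that subspace
([core_br]). Hence [D = 0].

For an abelian structure the Bismut connection is explicit:
[g (nabla_X Y) W = - g [Y, W] X] ([bismut_nabla]). Substituting this in the
curvature, the two terms of [rho] that are quadratic in [nabla] are traces of
endomorphisms that vanish for nilpotency reasons, and what remains is
[rho (X, Y) = - sum_j g [X, e_j] [Y, e_j]] ([ricciE]). So [rho] is symmetric,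
kills the center, is negative on non-central vectors, and, by abelianness and
because [J_i] permutes orthonormal bases, is [J_i]-invariant.

The center [z] and [v], its orthogonal complement, are nonzero and stable under
the three [J_i], hence have dimension at least 4; as the dimension is 8, both
have dimension exactly 4, and [v] is spanned by the orbit of any of its nonzero
vectors. A self-adjoint operator that commutes with the [J_i] is a scalar on
such a quaternionic line ([quat_line_scalar]); applied to the Ricci operator
this gives the constant [- lambda]. *)

(** * Inner products and orthogonal complements *)

Section InnerProduct.
Variables (R : realType) (V : vectType R) (g : {dot V for idfun}).
Implicit Types (x y : V) (U : {vspace V}) (e : seq V).

(* The generic bilinearity lemmas leave the form under a different structure
   projection, on which later rewrite rules for [g] no longer match; these
   restatements keep [g] itself. *)
Lemma dotDl x y w : g (x + y) w = g x w + g y w. Proof. exact: linearDl. Qed.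
Lemma dotBl x y w : g (x - y) w = g x w - g y w. Proof. exact: linearBl. Qed.
Lemma dotNl x w : g (- x) w = - g x w. Proof. exact: linearNl. Qed.
Lemma dotZl a x w : g (a *: x) w = a * g x w. Proof. exact: linearZl_LR. Qed.
Lemma dot0l w : g 0 w = 0. Proof. exact: linear0l. Qed.
Lemma dot_suml I r (F : I -> V) w :
  g (\sum_(i <- r) F i) w = \sum_(i <- r) g (F i) w.
Proof. exact: linear_sumlz. Qed.
Lemma dotDr x y w : g w (x + y) = g w x + g w y. Proof. exact: linearDr. Qed.
Lemma dotBr x y w : g w (x - y) = g w x - g w y. Proof. exact: linearBr. Qed.
Lemma dotNr x w : g w (- x) = - g w x. Proof. exact: linearNr. Qed.
Lemma dotZr a x w : g w (a *: x) = a * g w x. Proof. exact: linearZr_LR. Qed.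
Lemma dot0r w : g w 0 = 0. Proof. exact: linear0r. Qed.
Lemma dot_sumr I r (F : I -> V) w :
  g w (\sum_(i <- r) F i) = \sum_(i <- r) g w (F i).
Proof. exact: linear_sumr. Qed.

Lemma dotC x y : g x y = g y x.
Proof. by rewrite (hermC g) expr0 mul1r. Qed.

Lemma dot_ge0 x : 0 <= g x x.
Proof.
by have [->|/(neq0_dnorm_gt0 (s := g))/ltW//] := eqVneq x 0; rewrite dot0r.
Qed.

Lemma dot_eq0 x : g x x = 0 -> x = 0.
Proof.
move=> gx0; apply/eqP; apply: contraT => /(neq0_dnorm_gt0 (s := g)).
by rewrite gx0 ltxx.
Qed.

Lemma dot_inj x y : (forall w, g x w = g y w) -> x = y.
Proof.
by move=> gxy; apply/eqP; rewrite -subr_eq0; apply/eqP/dot_eq0; rewrite dotBl gxy subrr.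
Qed.

Lemma span_perp s x y :
  {in s, forall v, g x v = 0} -> y \in <<s>>%VS -> g x y = 0.
Proof.
move=> xs; rewrite -(in_tupleE s) => /coord_span ->.
rewrite dot_sumr big1 // => i _; rewrite dotZr xs ?mulr0 //; exact: mem_nth.
Qed.

Lemma pair_orthoP s : pair_ortho_rec g s ->
  {in s &, forall u v, u != v -> g u v = 0}.
Proof.
elim: s => //= a s IH; rewrite andbT => /andP[/allP as0 /IH{}IH] u v.
rewrite !inE => /predU1P[->|us] /predU1P[->|vs]; rewrite ?eqxx //.
- by move=> _; apply/eqP/as0.
- by move=> _; rewrite dotC; apply/eqP/as0.
- exact: IH.
Qed.

Lemma pairwise_orthogonal_free s : pairwise_orthogonal g s -> free s.
Proof.
rewrite /pairwise_orthogonal; elim: s => [|a s IH] /=; first by rewrite nil_free.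
rewrite andbT inE negb_or free_cons => /andP[/andP[a0 s0] /andP[/allP as0 sorth]].
rewrite IH ?s0 // andbT; apply: contra a0 => a_s.
rewrite eq_sym; apply/eqP/dot_eq0/(span_perp _ a_s) => v /as0; exact/eqP.
Qed.

Lemma orthogonal_basis_expand e x : orthonormal_basis g e ->
  x = \sum_(v <- e) g x v *: v.
Proof.
move=> [/andP[/eqP espan efree]]; rewrite orthonormalE.
move=> /andP[/allP enorm /andP[_ /pair_orthoP eorth]].
apply/eqP; rewrite -subr_eq0; set y := _ - _; apply/eqP/dot_eq0.
apply: (@span_perp e); last by rewrite espan memvf.
move=> u ue; rewrite dotBl dot_suml (bigD1_seq u) ?free_uniq //= big1_seq.
  by rewrite dotZl (eqP (enorm u ue)) mulr1 addr0 subrr.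
by move=> v /andP[vu ve]; rewrite dotZl (eorth v u) ?mulr0.
Qed.

(** Expand [A v] in the basis and exchange the two sums. This one identity
yields the cyclicity of the trace as well as the invariance of
[sum_v g (F v) (G v)] under an orthogonal change of basis. *)
Lemma sum_adjoint (F G : {linear V -> V}) (A A' : V -> V) e :
  orthonormal_basis g e -> (forall x y, g (A x) y = g x (A' y)) ->
  \sum_(v <- e) g (F (A v)) (G v) = \sum_(v <- e) g (F v) (G (A' v)).
Proof.
move=> eon AA'.
under eq_bigr => v _.
  rewrite {1}(orthogonal_basis_expand (A v) eon) linear_sum dot_suml.
  under eq_bigr do rewrite linearZ dotZl /= AA'.
  over.
rewrite exchange_big; apply: eq_bigr => w _.
rewrite [in RHS](orthogonal_basis_expand (A' w) eon) linear_sum dot_sumr.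
by apply: eq_bigr => v _; rewrite linearZ dotZr /= dotC.
Qed.

Lemma orthov_dotP U x : reflect {in U, forall y, g x y = 0} (x \in orthov g U).
Proof. exact: mem_orthovP. Qed.

(** Each further generator cuts the orthogonal complement by at most one
dimension. *)
Lemma dim_orthov_span s : (\dim {:V} <= size s + \dim (orthov g <<s>>))%N.
Proof.
elim: s => [|u s IH]; first by rewrite span_nil orthov0.
apply: (leq_trans IH); rewrite addSnnS leq_add2l.
have := leq_dim_orthov1 g u (orthov g <<s>>%VS).
rewrite -ltnS => /(leq_trans (leqSpred _)) /leq_trans; apply.
rewrite ltnS span_cons; apply: dimvS.
apply/subvP => x; rewrite memv_cap => /andP[/orthov_dotP xs /orthov_dotP xu].
apply/orthov_dotP => _ /memv_addP[a au [b bs ->]].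
by rewrite dotDr (xs b) ?(xu a) ?addr0.
Qed.

Lemma orthov_capv U : (U :&: orthov g U)%VS = 0%VS.
Proof.
apply/eqP; rewrite -subv0; apply/subvP => x; rewrite memv_cap memv0.
by move=> /andP[xU /orthov_dotP/(_ x xU)/dot_eq0 ->].
Qed.

Lemma dim_orthov_add U : (\dim U + \dim (orthov g U) = \dim {:V})%N.
Proof.
rewrite -dimv_disjoint_sum ?orthov_capv //.
apply/eqP; rewrite eqn_leq dimvS ?subvf //=.
rewrite dimv_disjoint_sum ?orthov_capv //.
by have := dim_orthov_span (vbasis U); rewrite size_tuple (span_basis (vbasisP U)).
Qed.

Lemma orthov_decomp U x :
  exists a b, [/\ a \in U, b \in orthov g U & x = a + b].
Proof.
have : x \in (U + orthov g U)%VS.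
  suff -> : (U + orthov g U)%VS = fullv by apply: memvf.
  apply/eqP; rewrite eqEdim subvf dimv_disjoint_sum ?orthov_capv //.
  by rewrite dim_orthov_add leqnn.
by move=> /memv_addP[a aU [b bU ->]]; exists a, b.
Qed.

(** [T] is nilpotent, with square zero, so its trace vanishes: with [P] a
projection onto [U] one has [T = P T] and [T P = 0], and the trace of [P T] is
that of [T P]. *)
Lemma trace_ker U (T T' : V -> V) e :
  orthonormal_basis g e -> (forall x y, g (T x) y = g x (T' y)) ->
  (forall x, T x \in U) -> (forall x, x \in U -> T x = 0) ->
  \sum_(v <- e) g (T v) v = 0.
Proof.
move=> eon TT' TU UT.
transitivity (\sum_(v <- e) g (projv U (T v)) (\1%VF v)).
  by apply: eq_bigr => v _; rewrite projv_id // id_lfunE.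
rewrite (sum_adjoint _ _ eon TT'); apply: big1_seq => v _.
by rewrite /= id_lfunE -TT' UT ?dot0l // memv_proj.
Qed.

End InnerProduct.

(** * Quaternionic relations *)

Section Quaternions.
Variables (R : realType) (V : vectType R) (br : {bilinear V -> V -> V}).
Variables (J : 'I_3 -> 'End(V)).
Hypothesis hJ : hypercomplex br J.

Lemma JJ i X : J i (J i X) = - X.
Proof. by case: hJ. Qed.

Lemma JN i X : J i (- X) = - J i X. Proof. exact: linearN. Qed.

Lemma J_inj i : injective (J i).
Proof. by move=> X Y /(congr1 (J i)); rewrite !JJ => /oppr_inj. Qed.

(** Indices are added modulo 3, so that a statement about a generic [i] covers
the three cyclic permutations of the complex structures; this lemma, [J_mulSC],
[J_mulS1] and [J_mulS2] are the entries of the quaternionic multiplication table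
used below. *)
Lemma J_mulS i X : J i (J (i + 1) X) = J (i + 2) X.
Proof.
have [_ J01 J2 _] := hJ.
have J10 Y : J 1 (J 0 Y) = - J 2 Y by rewrite -J2 J01 opprK.
have : i \in [:: 0; 1; 2 : 'I_3] by case: i => -[|[|[|]]].
rewrite !inE => /or3P[] /eqP->.
- by rewrite !add0r J2.
- have -> : 1 + 1 = 2 :> 'I_3 by apply: val_inj.
  have -> : 1 + 2 = 0 :> 'I_3 by apply: val_inj.
  by apply: (@J_inj 1); rewrite JJ J10.
- have -> : 2 + 1 = 0 :> 'I_3 by apply: val_inj.
  have -> : 2 + 2 = 1 :> 'I_3 by apply: val_inj.
  by rewrite -J2 J10 JN -J2 JJ opprK.
Qed.

Lemma J_mulSC i X : J (i + 1) (J i X) = - J (i + 2) X.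
Proof.
by apply: (@J_inj (i + 1)); apply: (@J_inj i); rewrite JJ !JN J_mulS !JJ.
Qed.

Lemma J_mulS1 i X : J (i + 1) (J (i + 2) X) = J i X.
Proof.
have := J_mulS (i + 1) X.
rewrite -(addrA i 1 1) -(addrA i 1 2) (_ : 1 + 2 = 0 :> 'I_3) ?addr0 //.
exact: val_inj.
Qed.

Lemma J_mulS2 i X : J (i + 2) (J i X) = J (i + 1) X.
Proof.
have := J_mulS (i + 2) X.
rewrite -(addrA i 2 1) -(addrA i 2 2) (_ : 2 + 1 = 0 :> 'I_3); last exact: val_inj.
by rewrite addr0 (_ : 2 + 2 = 1 :> 'I_3) //; apply: val_inj.
Qed.

Lemma ord3_shift (i a : 'I_3) : a \in [:: i; i + 1; i + 2].
Proof. by case: a i => -[|[|[|//]]] pa [] [|[|[|//]]] pi. Qed.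

End Quaternions.

(** * HKT structures on 2-step nilpotent Lie algebras are abelian *)

Section Abelian.
Variables (R : realType) (V : vectType R) (br : {bilinear V -> V -> V}).
Variables (J : 'I_3 -> 'End(V)) (g : {dot V for idfun}).
Hypothesis br_lie : lie_bracket br.

Lemma brNl X Y : br (- X) Y = - br X Y. Proof. exact: linearNl. Qed.
Lemma brNr X Y : br X (- Y) = - br X Y. Proof. exact: linearNr. Qed.
Lemma brDl X Y Z : br (X + Y) Z = br X Z + br Y Z. Proof. exact: linearDl. Qed.
Lemma brBl X Y Z : br (X - Y) Z = br X Z - br Y Z. Proof. exact: linearBl. Qed.

Lemma brC X Y : br X Y = - br Y X.
Proof.
have [br0 _] := br_lie; apply/eqP; rewrite -addr_eq0; apply/eqP.
have := br0 (X + Y); rewrite linearDl !linearDr !br0 add0r addr0 => <-.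
by rewrite addrC.
Qed.

Definition central Z := forall X, br Z X = 0.

Lemma central_r Z X : central Z -> br X Z = 0.
Proof. by move=> Zc; rewrite brC Zc oppr0. Qed.

Lemma centralN Z : central Z -> central (- Z).
Proof. by move=> Zc X; rewrite brNl Zc oppr0. Qed.

(** Membership in the largest subspace of the center that is stable under the
three complex structures. *)
Definition core Z := central Z /\ forall i, central (J i Z).

Hypothesis br_nil : two_step_nilpotent br.
Hypothesis br_hkt : hkt g br J.

Let hJ : hypercomplex br J. Proof. by case: br_hkt. Qed.

Lemma br_central X Y : central (br X Y).
Proof. by have [_ br2] := br_nil; exact: br2. Qed.

(** When the third argument is in the core, only one of the three terms of the
HKT form survives, so [g [J_a X, J_a Y] W] does not depend on [a]. Evaluating
this at [J_a X], [J_a Y] for the indices [a] and [a + 1] gives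
[g [X, Y] W = g [J_(a+2) X, J_(a+2) Y] W]. *)
Lemma core_br W a X Y : core W -> g (br (J a X) (J a Y)) W = g (br X Y) W.
Proof.
move=> [Wc JWc].
have [_ _ hF] := br_hkt.
have bri b c X' Y' : g (br (J b X') (J b Y')) W = g (br (J c X') (J c Y')) W.
  have := hF b c X' Y' W; rewrite /hkt_form !(central_r _ (JWc _)) !JWc.
  by rewrite !dot0l !addr0.
have := bri a (a + 1) (J a X) (J a Y).
rewrite !(JJ hJ) !(J_mulSC hJ) !brNl !brNr !opprK => ->.
exact: bri.
Qed.

Lemma nijenhuis_br i X Y :
  J i (br X Y - br (J i X) (J i Y)) = br (J i X) Y + br X (J i Y).
Proof.
have [_ _ _ /(_ i X Y)] := hJ.
by move/eqP; rewrite subr_eq0 => /eqP.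
Qed.

(** Write [I, J, K] for the structures of index [i], [i + 1], [i + 2].
Integrability of [J] at [Z] and of [K] at [I Z] (as [K I = J]) makes
[ad (J Z)] commute with [J] and [K], hence with [I = J K]. Every value
[W = [J Z, Y]] is then in the core, and [core_br] gives
[g W W = g [J J Z, J Y] W = - g [Z, J Y] W = 0]. *)
Lemma central_next i Z :
  central Z -> central (J i Z) -> central (J (i + 1) Z).
Proof.
move=> Zc IZc Y.
have brJ X : br (J (i + 1) Z) (J (i + 1) X) = J (i + 1) (br (J (i + 1) Z) X).
  apply: (J_inj hJ (i := i + 1)); rewrite (JJ hJ).
  have := nijenhuis_br (i + 1) Z X.
  by rewrite !Zc sub0r addr0 (JN J) => /(canRL opprK).
have KIZ : J (i + 2) (J i Z) = J (i + 1) Z.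
  by rewrite (J_mulS2 hJ).
have brK X : br (J (i + 1) Z) (J (i + 2) X) = J (i + 2) (br (J (i + 1) Z) X).
  apply: (J_inj hJ (i := i + 2)); rewrite (JJ hJ).
  have := nijenhuis_br (i + 2) (J i Z) X; rewrite KIZ.
  by rewrite !IZc sub0r addr0 (JN J) => /(canRL opprK).
have brI X : br (J (i + 1) Z) (J i X) = J i (br (J (i + 1) Z) X).
  by rewrite -(J_mulS1 hJ i X) -(J_mulS1 hJ i (br _ _)) brJ brK.
set W := br _ _.
have Wcore : core W.
  split=> [|a]; first exact: br_central.
  have := ord3_shift i a; rewrite !inE => /or3P[] /eqP->;
    rewrite /W -?brI -?brJ -?brK; apply: br_central.
apply: (dot_eq0 (g := g)).
by rewrite -(core_br (i + 1) _ _ Wcore) (JJ hJ) brNl Zc oppr0 dot0l.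
Qed.

(** The case of index [i + 2] is [central_next] for the pair [J_i Z],
[J_i (J_i Z) = - Z]. *)
Lemma central_core i Z : central Z -> central (J i Z) -> core Z.
Proof.
move=> Zc IZc; split=> // a.
have JZc := central_next Zc IZc.
have := ord3_shift i a.
rewrite !inE => /or3P[] /eqP-> //.
rewrite -[J _ _]opprK -(J_mulSC hJ); apply: centralN; apply: central_next => //.
by rewrite (JJ hJ); exact: centralN.
Qed.

(** The defect [D] and [J_i D] are central, the latter by integrability, so [D]
is in the core; [core_br] says that [D] is orthogonal to the core. *)
Lemma hkt_abelian i X Y : br (J i X) (J i Y) = br X Y.
Proof.
apply/eqP; rewrite eq_sym -subr_eq0; set D := _ - _.
have Dcore : core D.
  apply: (central_core (i := i)) => Y'; first by rewrite brBl !br_central subrr.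
  by rewrite nijenhuis_br brDl !br_central addr0.
by apply/eqP/(dot_eq0 (g := g)); rewrite {1}/D dotBl (core_br _ _ _ Dcore) subrr.
Qed.

Lemma central_J i Z : central Z -> central (J i Z).
Proof.
by move=> Zc X; rewrite -(hkt_abelian i) (JJ hJ) brNl Zc oppr0.
Qed.

Lemma br_J i X Y : br (J i X) Y = - br X (J i Y).
Proof. by rewrite -[in RHS](hkt_abelian i) (JJ hJ) brNr opprK. Qed.

End Abelian.

(** * The Bismut connection of an abelian HKT structure *)

Section Bismut.
Variables (R : realType) (V : vectType R) (br nabla : {bilinear V -> V -> V}).
Variables (J : 'I_3 -> 'End(V)) (g : {dot V for idfun}).
Hypothesis br_lie : lie_bracket br.
Hypothesis br_nil : two_step_nilpotent br.
Hypothesis br_hkt : hkt g br J.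
Hypothesis nabla_bismut : bismut g br J nabla.

Let hJ : hypercomplex br J. Proof. by case: br_hkt. Qed.

Lemma dot_JNr i X Y : g (J i X) Y = - g X (J i Y).
Proof.
have [_ gJ _] := br_hkt.
by rewrite -(gJ i X) (JJ hJ) dotNr opprK.
Qed.

Lemma bismut_torsionC X Y Z :
  g X (torsion br nabla Y Z) = - g Y (torsion br nabla X Z).
Proof.
have [_ _ cXX _] := nabla_bismut.
have tDl A B C :
    torsion br nabla (A + B) C = torsion br nabla A C + torsion br nabla B C.
  rewrite /torsion (linearDr nabla) (linearDl nabla) (linearDl br) !opprD.
  by rewrite (addrACA (nabla A C)) [RHS]addrACA.
apply/eqP; rewrite -addr_eq0; apply/eqP.
have := cXX (X + Y) Z; rewrite tDl dotDl !(dotDr _ (torsion br nabla X Z)).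
by rewrite !cXX add0r addr0.
Qed.

(** The connection defined by the right-hand side has all the properties of the
Bismut connection, so this is its uniqueness. The difference [D] of the two
connections is skew in its last two arguments since both are metric, and then in
the first two since both torsions are 3-forms (a Koszul-type cancellation). It
satisfies [D A (J_0 B) C = - D A B (J_0 C)], and moving [J_0] around the three
slots of a 3-form with this property changes its sign, so that [D = 0]. *)
Lemma bismut_nabla X Y W : g (nabla X Y) W = - g (br Y W) X.
Proof.
have [nabla_g nabla_J _ _] := nabla_bismut.
pose D X Y Z := g (nabla X Y) Z + g (br Y Z) X.
have D23 A B C : D A B C = - D A C B.
  have := nabla_g A B C; rewrite /D (brC br_lie C B); rewrite dotNl (dotC g B); lra.
have D12 A B C : D A B C = - D B A C.
  have tor P Q S : g P (torsion br nabla Q S) =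
      D Q S P - D S Q P - g (br S P) Q + g (br Q P) S - g (br Q S) P.
    rewrite /D /torsion !dotBr !(dotC g P); ring.
  have c := bismut_torsionC; have e := brC br_lie.
  have := D23 A B C; have := D23 A C B; have := D23 B A C; have := D23 C A B.
  have := c A B C; have := c B C A; have := c C A B.
  have := c A C B; have := c B A C; have := c C B A.
  rewrite !tor (e B A) (e C A) (e C B) !dotNl; lra.
have DJ i A B C : D A (J i B) C = - D A B (J i C).
  by rewrite /D nabla_J dot_JNr (br_J br_lie br_nil br_hkt) dotNl opprD.
have DJ12 A B C : D (J 0 A) B C = D A (J 0 B) C.
  by rewrite DJ D12 DJ D12 !opprK.
have D0 A B C : D A (J 0 B) C = 0.
  have := D23 (J 0 A) B C; have := DJ12 A B C; have := DJ12 A C B.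
  have := D23 A (J 0 C) B; have := DJ 0 A B C; lra.
apply/eqP; rewrite -addr_eq0 -[Y]opprK -(JJ hJ 0 (- Y)); apply/eqP/D0.
Qed.

End Bismut.

(** * Quaternionic lines *)

Section Quaternionic.
Variables (R : realType) (V : vectType R) (br : {bilinear V -> V -> V}).
Variables (J : 'I_3 -> 'End(V)) (g : {dot V for idfun}).
Hypothesis br_hkt : hkt g br J.
Implicit Types (u x y : V) (U : {vspace V}).

Let hJ : hypercomplex br J. Proof. by case: br_hkt. Qed.

Definition quat_orbit u := [:: u; J 0 u; J 1 u; J 2 u].

Lemma dot_J0 i u : g u (J i u) = 0.
Proof. by have := dot_JNr br_hkt i u u; rewrite dotC; lra. Qed.

Lemma dot_JJ i j u : i != j -> g (J i u) (J j u) = 0.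
Proof.
move=> neq_ij; have := ord3_shift i j; rewrite !inE => /or3P[] /eqP ej.
- by rewrite ej eqxx in neq_ij.
- by rewrite ej (dot_JNr br_hkt) (J_mulS hJ) dot_J0 oppr0.
- by rewrite ej dotC (dot_JNr br_hkt) (J_mulS2 hJ) dot_J0 oppr0.
Qed.

Lemma quat_orbit_free u : u != 0 -> free (quat_orbit u).
Proof.
move=> u0; have Ju0 i : J i u != 0.
  apply: contraNneq u0 => Ju; rewrite -[u]opprK -(JJ hJ i u) Ju.
  by rewrite linear0 oppr0.
apply: (pairwise_orthogonal_free (g := g)).
rewrite /pairwise_orthogonal /= !inE !negb_or !(eq_sym 0).
by rewrite u0 !Ju0 !dot_J0 !dot_JJ ?eqxx.
Qed.

Section Stable.
Variable U : {vspace V}.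
Hypothesis U_J : forall i x, x \in U -> J i x \in U.

Lemma quat_orbit_sub u : u \in U -> (<<quat_orbit u>> <= U)%VS.
Proof.
move=> uU; apply/span_subvP => x; rewrite !inE => /or4P[] /eqP-> //; exact: U_J.
Qed.

Lemma quat_dim_ge4 : U != 0%VS -> (4 <= \dim U)%N.
Proof.
rewrite -vpick0 => /quat_orbit_free /eqP dim4.
rewrite -[4%N]dim4; exact/dimvS/quat_orbit_sub/memv_pick.
Qed.

Lemma quat_orbit_span u : \dim U = 4%N -> u \in U -> u != 0 ->
  <<quat_orbit u>>%VS = U.
Proof.
move=> dimU uU u0; apply/eqP; rewrite eqEdim quat_orbit_sub // dimU.
by rewrite (eqP (quat_orbit_free u0)).
Qed.

(** Schur's lemma for a quaternionic line. [S u] is orthogonal to each [J_i u],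
since [g (S u) (J_i u) = g u (J_i (S u)) = - g (J_i u) (S u)]; as [U] is spanned
by [u] and the [J_i u], this forces [S u] to be a multiple of [u], and
commutation with the [J_i] extends this to [U]. *)
Lemma quat_line_scalar (S : 'End(V)) u :
  \dim U = 4%N -> u \in U -> u != 0 ->
  (forall x, x \in U -> S x \in U) ->
  (forall x y, g (S x) y = g x (S y)) ->
  (forall i x, S (J i x) = J i (S x)) ->
  forall x, x \in U -> S x = (g (S u) u / g u u) *: x.
Proof.
move=> dimU uU u0 SU Ssym SJ; set c := _ / _.
have eU := quat_orbit_span dimU uU u0.
have Su : S u = c *: u.
  apply/eqP; rewrite -subr_eq0; set y := _ - _; apply/eqP/(dot_eq0 (g := g)).
  have y_perp : {in quat_orbit u, forall x, g y x = 0}.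
    have yJ i : g y (J i u) = 0.
      rewrite dotBl dotZl dot_J0 mulr0 subr0.
      have := Ssym u (J i u); rewrite SJ (dotC _ u) (dot_JNr br_hkt) dotC; lra.
    move=> x; rewrite !inE => /or4P[] /eqP-> //.
    rewrite dotBl dotZl divfK ?subrr //.
    by apply: contraNneq u0 => /dot_eq0->.
  by apply: (span_perp y_perp); rewrite eU /y memvB ?memvZ ?SU.
have JZ i : J i (c *: u) = c *: J i u by exact: linearZ.
have kerE x : (x \in lker (S - c *: \1%VF)) = (S x == c *: x).
  by rewrite memv_ker add_lfunE opp_lfunE scale_lfunE id_lfunE subr_eq0.
have Sq : (<<quat_orbit u>> <= lker (S - c *: \1%VF))%VS.
  apply/span_subvP => x; rewrite kerE !inE => /or4P[] /eqP->;
    by rewrite ?SJ Su ?JZ.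
by move=> x; rewrite -eU => /(subvP Sq); rewrite kerE => /eqP.
Qed.

End Stable.
End Quaternionic.

(** * The Ricci tensor *)

Section Ricci.
Variables (R : realType) (V : vectType R) (br nabla : {bilinear V -> V -> V}).
Variables (J : 'I_3 -> 'End(V)) (g : {dot V for idfun}) (e : seq V).
Hypothesis br_lie : lie_bracket br.
Hypothesis br_nil : two_step_nilpotent br.
Hypothesis br_hkt : hkt g br J.
Hypothesis nabla_bismut : bismut g br J nabla.
Hypothesis e_on : orthonormal_basis g e.

Let nablaE := bismut_nabla br_lie br_nil br_hkt nabla_bismut.

Lemma nabla_skew X Y W : g (nabla X Y) W = - g Y (nabla X W).
Proof.
by have [/(_ X Y W)/eqP + _ _ _] := nabla_bismut; rewrite addr_eq0 => /eqP.
Qed.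

(** Of the three curvature terms, the first contributes the trace of
[ad (nabla_X Y)], which vanishes by [trace_ker] with [U] the center. The second
contributes, by skewness of [nabla_X], the trace of [nabla_X] composed with
[ad Y], which vanishes because [nabla_X] kills the center. The third is the
right-hand side. *)
Lemma ricciE X Y : ricci g br nabla e X Y = - \sum_(v <- e) g (br X v) (br Y v).
Proof.
have trace1 : \sum_(v <- e) g (nabla v (nabla X Y)) v = 0.
  under eq_bigr do rewrite nablaE.
  rewrite sumrN; apply/eqP; rewrite oppr_eq0; apply/eqP.
  apply: (trace_ker (U := lie_center br) (T' := fun y => - nabla y (nabla X Y))) => //.
  - by move=> x y; rewrite dotNr (dotC g x) nablaE opprK.
  - by move=> x; apply/mem_lie_centerP/br_central.
  - by move=> x /mem_lie_centerP; apply: central_r.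
have trace2 : \sum_(v <- e) g (nabla X (nabla v Y)) v = 0.
  transitivity (\sum_(v <- e) g (br Y (nabla X v)) (\1%VF v)).
    by apply: eq_bigr => v _; rewrite nabla_skew nablaE opprK id_lfunE.
  rewrite (sum_adjoint (A' := fun y => - nabla X y) _ _ e_on); last first.
    by move=> x y; rewrite nabla_skew dotNr.
  apply: big1_seq => v _ /=.
  by rewrite id_lfunE dotNr -nabla_skew nablaE (br_central br_nil) dot0l oppr0.
rewrite -sumrN /ricci /curvature.
under eq_bigr do rewrite !dotBl (nablaE (br _ X)) opprK.
rewrite big_split /= sumrB trace1 trace2 subrr add0r; apply: eq_bigr => v _.
by rewrite (brC br_lie v X) dotNr dotC.
Qed.

Lemma ricciC X Y : ricci g br nabla e X Y = ricci g br nabla e Y X.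
Proof. by rewrite !ricciE; congr (- _); apply: eq_bigr => v _; rewrite dotC. Qed.

Lemma ricci_central Z X : central br Z -> ricci g br nabla e Z X = 0.
Proof.
by move=> Zc; rewrite ricciE big1_seq ?oppr0 // => v _; rewrite Zc dot0l.
Qed.

(** By abelianness [J_i] moves from [X] to the summation variable with a sign;
[sum_adjoint] carries it to the other factor, and abelianness puts it on [Y]. *)
Lemma ricci_J i X Y :
  ricci g br nabla e (J i X) Y = - ricci g br nabla e X (J i Y).
Proof.
rewrite !ricciE opprK -sumrN.
have brJ := br_J br_lie br_nil br_hkt i.
under eq_bigr do rewrite brJ dotNl opprK.
rewrite (sum_adjoint (A' := fun y => - J i y) _ _ e_on); last first.
  by move=> x y; rewrite (dot_JNr br_hkt) dotNr.
by apply: eq_bigr => v _ /=; rewrite (brNr br) -brJ.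
Qed.

Lemma ricci_lt0 X : ~ central br X -> ricci g br nabla e X X < 0.
Proof.
move=> Xnc; rewrite ricciE oppr_lt0 lt_def sumr_ge0 ?andbT; last first.
  by move=> v _; apply: dot_ge0.
apply/eqP => /eqP; rewrite big_seq psumr_eq0; last by move=> v _; apply: dot_ge0.
move=> /allP sum0; apply: Xnc => Y.
rewrite (orthogonal_basis_expand Y e_on) linear_sumr big1_seq // => v /andP[_ ve].
have := sum0 v ve; rewrite ve => /eqP/dot_eq0 brv.
by rewrite linearZr_LR /= brv scaler0.
Qed.

(** The formula comes from [g [X, v] [Y, v] = g (nabla_[X, v] v) Y], which
rewrites each term of [ricciE] as a pairing with [Y]. *)
Definition ricci_op : 'End(V) :=
  - \sum_(v <- e) (linfun (applyr nabla v) \o linfun (applyr br v))%VF.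

Lemma ricci_opP X Y : g (ricci_op X) Y = ricci g br nabla e X Y.
Proof.
rewrite ricciE opp_lfunE sum_lfunE dotNl dot_suml; congr (- _).
apply: eq_bigr => v _; rewrite comp_lfunE !lfunE /=.
by rewrite nabla_skew dotC nablaE opprK dotC.
Qed.

End Ricci.

(** * Curvature in dimension 8 *)

Theorem mainTheorem6 (R : realType) (n : vectType R)
    (br : {bilinear n -> n -> n}) (J : 'I_3 -> 'End(n)) (g : {dot n for idfun})
    (nabla : {bilinear n -> n -> n}) (e : seq n) :
  \dim {:n} = 8%N ->
  lie_bracket br ->
  two_step_nilpotent br ->
  hkt g br J ->
  bismut g br J nabla ->
  orthonormal_basis g e ->
  let rho := ricci g br nabla e in
  let z := lie_center br in
  let v := orthov g z in
  (forall Z X, Z \in z -> rho Z X = 0) /\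
  (exists lambda : R,
    [/\ 0 < lambda,
        forall X, X \in v -> metric_norm g X = 1 -> rho X X = - lambda &
        exists2 Ric : 'End(n),
          forall X Y, g (Ric X) Y = rho X Y &
          forall mu : R, passmx.leigenvalue Ric mu <-> mu = 0 \/ mu = - lambda]).
Proof.
move=> dim8 br_lie br_nil br_hkt nabla_b e_on rho z v.
have rhoZ Z X : Z \in z -> rho Z X = 0.
  by move/mem_lie_centerP; apply: ricci_central br_lie br_nil br_hkt nabla_b e_on _ _.
split=> //.
have [Ric RicP] : exists Ric : 'End(n), forall X Y, g (Ric X) Y = rho X Y.
  exists (ricci_op br nabla e).
  exact: ricci_opP br_lie br_nil br_hkt nabla_b e_on.
have rhoC : forall X Y, rho X Y = rho Y X.
  exact: ricciC br_lie br_nil br_hkt nabla_b e_on.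
have RicZ Z : Z \in z -> Ric Z = 0.
  by move=> Zz; apply: (dot_inj (g := g)) => W; rewrite RicP rhoZ // dot0l.
have Ric_v X : Ric X \in v.
  by apply/orthov_dotP => Z Zz; rewrite RicP rhoC rhoZ.
have zJ i X : X \in z -> J i X \in z.
  move/mem_lie_centerP => Xz; apply/mem_lie_centerP.
  by have := central_J br_lie br_nil br_hkt i Xz; apply.
have vJ i X : X \in v -> J i X \in v.
  move=> /orthov_dotP Xv; apply/orthov_dotP => Z Zz.
  by rewrite (dot_JNr br_hkt) Xv ?oppr0 ?zJ.
have [[X0 [Y0 br0]] br2] := br_nil.
have z_n0 : z != 0%VS.
  apply/eqP => z0; apply: br0; apply/eqP; rewrite -memv0 -z0.
  exact/mem_lie_centerP/br2.
have v_n0 : v != 0%VS.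
  apply/eqP => v0; apply: br0; have [a [b [az bv ->]]] := orthov_decomp g z X0.
  move: bv; rewrite -/v v0 memv0 => /eqP ->.
  by rewrite addr0; apply/mem_lie_centerP: Y0.
have dimv4 : \dim v = 4%N.
  have := dim_orthov_add g z; rewrite dim8 -/v => dim_zv.
  have z4 := quat_dim_ge4 br_hkt zJ z_n0; have v4 := quat_dim_ge4 br_hkt vJ v_n0.
  apply/eqP; rewrite eqn_leq v4 andbT -(leq_add2l 4) -[(4 + 4)%N]dim_zv.
  by rewrite leq_add2r.
set V0 := vpick v.
have V0v : V0 \in v by apply: memv_pick.
have V0_n0 : V0 != 0 by rewrite vpick0.
have zv_n0 X : X \in z -> X \in v -> X = 0.
  by move=> Xz Xv; apply/eqP; rewrite -memv0 -(orthov_capv g z) memv_cap Xz.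
(* [c] is the value of [- lambda]. *)
pose c := g (Ric V0) V0 / g V0 V0.
have Ric_c : forall X, X \in v -> Ric X = c *: X.
  apply: (quat_line_scalar br_hkt vJ dimv4 V0v V0_n0) => //.
  - by move=> X Y; rewrite RicP rhoC -RicP dotC.
  - move=> i X; apply: (dot_inj (g := g)) => Y; rewrite RicP (dot_JNr br_hkt) RicP.
    exact: ricci_J br_lie br_nil br_hkt nabla_b e_on i X Y.
have c_lt0 : c < 0.
  rewrite /c pmulr_llt0 ?invr_gt0 ?neq0_dnorm_gt0 // RicP.
  apply: (ricci_lt0 br_lie br_nil br_hkt nabla_b e_on) => /mem_lie_centerP V0z.
  by move: V0_n0; rewrite (zv_n0 V0) ?eqxx.
exists (- c); rewrite opprK; split; first by rewrite oppr_gt0.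
  move=> X Xv normX; rewrite -RicP Ric_c // dotZl.
  by rewrite -[g X X]sqr_sqrtr ?dot_ge0 // -/(metric_norm g X) normX expr1n mulr1.
exists Ric => // mu; rewrite /passmx.leigenvalue.
have eigE X : (X \in passmx.leigenspace Ric mu) = (Ric X == mu *: X).
  by rewrite memv_ker add_lfunE opp_lfunE scale_lfunE id_lfunE subr_eq0.
split=> [|mu_eq].
  rewrite -vpick0; set X := vpick _ => X_n0.
  have /eqP : Ric X == mu *: X by rewrite -eigE memv_pick.
  (* The components [a], [b] of an eigenvector in [z] and [v] satisfy
     [c b = mu a + mu b], so that [mu a = 0] and [(c - mu) b = 0]. *)
  have [a [b [az bv eX]]] := orthov_decomp g z X.
  rewrite eX linearD /= RicZ // Ric_c // add0r scalerDr => /eqP.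
  rewrite -subr_eq -scalerBl => /eqP eab.
  have b0 : (c - mu) *: b = 0 by apply: zv_n0; [rewrite eab|]; apply: rpredZ.
  move: eab; rewrite b0 => /esym/eqP.
  rewrite scaler_eq0 => /predU1P[|/eqP a0]; first by left.
  move/eqP: b0; rewrite scaler_eq0 subr_eq0 => /predU1P[|/eqP b0]; first by right.
  by rewrite eX a0 b0 addr0 eqxx in X_n0.
have [X X_n0 eX] : exists2 X, X != 0 & Ric X = mu *: X.
  case: mu_eq => ->; last by exists V0; rewrite ?Ric_c.
  by exists (vpick z); rewrite ?vpick0 // scale0r RicZ ?memv_pick.
apply: contraNneq X_n0 => eig0; rewrite -memv0 -eig0 eigE; exact/eqP.
Qed.
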